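(* Let $X$ be a set and let $\mathcal{L}$ and $\mathcal{R}$ be two nests on $X$ such that $\mathcal{L}\cup\mathcal{R}$ is $T_1$-separating, and equip $X$ with the topology having $\mathcal{L}\cup\mathcal{R}$ as a subbase (so that $\mathcal{L}$ and $\mathcal{R}$ consist of open sets). If $X$ is connected with respect to this topology, then $X$ is a LOTS.
   Context: A nest on $X$ is a family of subsets of $X$ that is linearly ordered by inclusion. A collection $\mathcal{S}$ of subsets of $X$ is $T_1$-separating if for all $x\neq y$ in $X$ there exist $S,T\in\mathcal{S}$ such that $x\in S$, $y\notin S$, $y\in T$ and $x\notin T$. A LOTS (linearly ordered topological space) is a topological space whose topology equals the order topology of some linear order on the underlying set. *)

(* Defs.v *)
From HB Require Import structures.
From mathcomp Require Import all_boot all_order.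
From mathcomp Require Import boolp classical_sets topology.

Set Implicit Arguments.
Unset Strict Implicit.
Unset Printing Implicit Defensive.

Local Open Scope classical_set_scope.

Definition nest (X : Type) (F : set (set X)) : Prop := total_on F subset.

Definition T1_separating (X : Type) (F : set (set X)) : Prop :=
  forall x y : X, x <> y ->
    exists S T : set X, [/\ F S, F T, S x /\ ~ S y & T y /\ ~ T x].

(** The carrier [X] with the topology having [F] as a subbase. As usual, the
    empty intersection counts as a finite intersection, so [F] need not cover
    [X]. The choice structure is the classical one. *)
Definition subbase_topology (X : Type) (F : set (set X)) : Type := X.

HB.instance Definition _ (X : Type) (F : set (set X)) :=
  Choice.copy (subbase_topology F) {classic X}.
HB.instance Definition _ (X : Type) (F : set (set X)) :=
  @isSubBaseTopological.Build (subbase_topology F) (set X) F id.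

(** [O] is a bundled linear order on the carrier of [X]; the open sets on the
    left are those of the library's order topology for this order. *)
Definition LOTS (X : topologicalType) : Prop :=
  exists (d : Order.disp_t) (O : Order.Total d X),
    @open (order_topology (Order.Total.Pack O)) = @open X.

(* Main.v *)
Require Import Defs.
From mathcomp Require Import all_boot all_order.
From mathcomp Require Import boolp classical_sets topology.
From HB Require Import structures.
From mathcomp Require Import finmap interval filter set_interval.

(** Write [x <_F y] when some member of the family [F] contains [x] but not
    [y]. On a nest this relation is a strict partial order whose lower sets
    include every member of the nest. Two points are separated in both
    directions by [L `|` R], and a single nest cannot do this alone; so one
    direction comes from [L] and the other from [R]. Hence [<_L] is a linear
    order and [<_R] is the reverse order: members of [L] are lower sets and
    members of [R] are upper sets.

    The open rays [{y | y <_L x}] and [{y | x <_L y} = {y | y <_R x}] are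
    unions of members of [L] and of [R] ([nest_ray_open]), so the order
    topology is always coarser than the subbase topology.

    Connectedness gives the converse. Take a member [U] of [L]. If [U] has a
    greatest element [m], its complement is the open ray above [m], so [U] is
    clopen and nonempty, and [U] is the whole space
    ([connected_open_lower_no_max]). If [U] has no greatest element, it is the
    union of the open rays below its points ([no_max_lower_open]). In both
    cases [U] is open in the order topology. The argument only uses a strict
    linear order and its rays, so running it with [<_R] handles [R]. *)

Set Implicit Arguments.
Unset Strict Implicit.
Unset Printing Implicit Defensive.

Local Open Scope classical_set_scope.

(** * Topologies given by a subbase *)

(** The open sets of a topology built from a subbase are by definition the
    unions of subfamilies of [finI_from D b], so this gives the minimality of
    both [subbase_topology] and [order_topology]. *)
Lemma finI_from_bigcup_open (T : topologicalType) (I : choiceType) (D : set I)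
    (b : I -> set T) (E : set (set T)) :
  (forall i, D i -> open (b i)) -> E `<=` finI_from D b ->
  open (\bigcup_(A in E) A).
Proof.
move=> openb subE; apply: bigcup_open => A /subE [K KD <-].
rewrite bigcap_fset big_seq; elim/big_ind: _ => [||i iK].
- exact: openT.
- exact: openI.
- by apply: openb; exact/set_mem/KD.
Qed.

Lemma subbase_open (X : Type) (F : set (set X)) U :
  F U -> @open (subbase_topology F) U.
Proof.
move=> FU; exists [set U]; last by rewrite bigcup_set1.
move=> _ ->; exists [fset U]%fset; last by rewrite set_fset1 bigcap_set1.
by move=> V; rewrite !inE => /eqP ->; exact: mem_set.
Qed.

Lemma subbase_open_min (T : topologicalType) (F : set (set T)) :
  F `<=` open -> @open (subbase_topology F) `<=` @open T.
Proof.
move=> openF _ [E EF <-].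
exact: (@finI_from_bigcup_open T (set T) F id E openF EF).
Qed.

Lemma order_open_min (d : Order.disp_t) (T : topologicalType)
    (O : Order.Total d T) (oT : orderType d := Order.Total.Pack O) :
  (forall x : oT, @open T [set y : oT | (y < x)%O]) ->
  (forall x : oT, @open T [set y : oT | (x < y)%O]) ->
  @open (order_topology oT) `<=` @open T.
Proof.
move=> openl openr _ [E EF <-].
refine (@finI_from_bigcup_open T (interval oT) _ (fun i => [set` i]) E _ EF).
case=> [[[]l|[]] [[]r|[]]] //= _.
- by rewrite (@set_itvoy d oT); exact: openr.
- by rewrite (@set_itvNyo d oT); exact: openl.
- by rewrite (@set_itvNyy d oT); exact: openT.
Qed.

(** * Linear orders from propositional relations *)

(** The bundled structure is built on [{classic T}], which supplies the choice
    structure and is convertible to [T]. *)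
Lemma strict_total_Order (d : Order.disp_t) (T : Type) (lt : T -> T -> Prop) :
  (forall x, ~ lt x x) -> (forall x y z, lt x y -> lt y z -> lt x z) ->
  (forall x y, x <> y -> lt x y \/ lt y x) ->
  exists O : Order.Total d T,
    forall x y, @Order.lt d (Order.Total.Pack O) x y <-> lt x y.
Proof.
move=> lt_irr lt_trans lt_total.
pose ltb (x y : {classic T}) := `[< lt x y >].
have irr : irreflexive ltb by move=> x; apply/asboolP/lt_irr.
have tr : transitive ltb.
  by move=> y x z /asboolP xy /asboolP yz; apply/asboolP; exact: lt_trans yz.
pose ltP := Order.Lt_isPOrder.Build d {classic T} irr tr.
pose P := HB.pack_for (porderType d) {classic T} ltP.
have tot : total (<=%O : rel P).
  move=> x y; rewrite !Order.POrderTheory.le_eqVlt.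
  have [//|/eqP xy] := eqVneq x y.
  case: (lt_total x y xy) => h; apply/orP; [left|right]; apply/orP; right;
  exact/asboolP.
pose totP := Order.POrder_isTotal.Build d P tot.
pose O := HB.pack_for (orderType d) {classic T} P totP.
exists (Order.Total.class O) => x y.
exact: (iff_sym (rwP (@asboolP (lt x y)))).
Qed.

(** * The order induced by a nest *)

Definition nest_lt (X : Type) (F : set (set X)) (x y : X) : Prop :=
  exists2 U, F U & U x /\ ~ U y.

Lemma nest_lt_irr (X : Type) (F : set (set X)) x : ~ nest_lt F x x.
Proof. by case=> U _ []. Qed.

(** A member [V] witnessing [nest_lt F x y] cannot contain [U], which has the
    point [y]; so [V] is a subset of [U]. *)
Lemma nest_lower (X : Type) (F : set (set X)) U x y :
  nest F -> F U -> U y -> nest_lt F x y -> U x.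
Proof.
move=> nestF FU Uy [V FV [Vx nVy]].
by case: (nestF U V FU FV) => [/(_ y Uy)//|]; exact.
Qed.

Lemma nest_lt_asym (X : Type) (F : set (set X)) x y :
  nest F -> nest_lt F x y -> ~ nest_lt F y x.
Proof. by move=> nestF [U FU [Ux nUy]] /(nest_lower nestF FU Ux). Qed.

Lemma nest_lt_trans (X : Type) (F : set (set X)) x y z :
  nest F -> nest_lt F x y -> nest_lt F y z -> nest_lt F x z.
Proof.
move=> nestF xy [U FU [Uy nUz]].
by exists U => //; split=> //; exact: nest_lower nestF FU Uy xy.
Qed.

Lemma nest_ray_open (T : topologicalType) (F : set (set T)) y :
  F `<=` open -> open [set x | nest_lt F x y].
Proof.
move=> openF.
have -> : [set x | nest_lt F x y] = \bigcup_(U in F `&` [set U | ~ U y]) U.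
  apply/seteqP; split=> x; first by case=> U FU [Ux nUy]; exists U.
  by case=> U [FU nUy] Ux; exists U.
by apply: bigcup_open => U [FU _]; exact: openF.
Qed.

(** The two sets that separate [x] and [y] are incomparable for inclusion, so
    they lie in different nests. *)
Lemma separating_nests_lt (X : Type) (L R : set (set X)) x y :
  nest L -> nest R -> T1_separating (L `|` R) -> x <> y ->
  nest_lt L x y /\ nest_lt R y x \/ nest_lt R x y /\ nest_lt L y x.
Proof.
move=> nestL nestR sep xy.
have [S [T [FS FT Sxy Tyx]]] := sep x y xy.
have not_both (F : set (set X)) : nest F -> F S -> ~ F T.
  move=> nestF FS' FT'.
  by case: (@nest_lt_asym X F x y nestF); [exists S|exists T].
case: FS FT => [LS|RS] [LT|RT].
- by case: (not_both L).
- by left; split; [exists S|exists T].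
- by right; split; [exists S|exists T].
- by case: (not_both R).
Qed.

Lemma separating_nests_lt_rev (X : Type) (L R : set (set X)) x y :
  nest L -> nest R -> T1_separating (L `|` R) ->
  nest_lt R x y <-> nest_lt L y x.
Proof.
move=> nestL nestR sep.
have neq (F : set (set X)) u v : nest_lt F u v -> u <> v.
  by move=> uv e; rewrite e in uv; exact: nest_lt_irr uv.
split=> xy.
  case: (separating_nests_lt nestL nestR sep (neq _ _ _ xy)) => [[_ yx]|[]//].
  by case: (nest_lt_asym nestR xy yx).
case: (separating_nests_lt nestL nestR sep (neq _ _ _ xy)) => [[]//|[_ yx]].
by case: (nest_lt_asym nestL xy yx).
Qed.

(** * Lower sets in a connected space *)

Lemma connected_clopen_setT (T : topologicalType) (U : set T) :
  connected [set: T] -> U !=set0 -> open U -> open (~` U) -> U = setT.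
Proof.
move=> connT U0 oU oUC; apply: connT => //; exists U => //; rewrite ?setTI//.
by rewrite -[U]setCK; apply: open_closedC.
Qed.

(** The complement of a lower set with greatest element [m] is the ray above
    [m], so an open such set is clopen. *)
Lemma connected_open_lower_no_max (T : topologicalType) (lt : T -> T -> Prop)
    (U : set T) :
  (forall x y, x <> y -> lt x y \/ lt y x) ->
  (forall x y, lt x y -> ~ lt y x) ->
  connected [set: T] -> (forall x, open [set y | lt x y]) ->
  open U -> (forall x y, U y -> lt x y -> U x) ->
  U = setT \/ forall x, U x -> exists2 y, U y & lt x y.
Proof.
move=> lt_total lt_asym connT openr oU lowU.
have [|/existsNP[m]] := pselect (forall x, U x -> exists2 y, U y & lt x y).
  by right.
move=> /not_implyP[Um mmax]; left.
apply: connected_clopen_setT => //; first by exists m.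
suff -> : ~` U = [set y | lt m y] by [].
apply/seteqP; split=> y; last by move=> my Uy; apply: mmax; exists y.
move=> nUy; have /lt_total[//|ym] : m <> y by move=> my; rewrite -my in nUy.
by case: nUy; exact: lowU ym.
Qed.

Lemma no_max_lower_open (T : topologicalType) (lt : T -> T -> Prop)
    (U : set T) :
  (forall x, open [set y | lt y x]) -> (forall x y, U y -> lt x y -> U x) ->
  (forall x, U x -> exists2 y, U y & lt x y) -> open U.
Proof.
move=> openl lowU nomax.
have -> : U = \bigcup_(x in U) [set y | lt y x].
  apply/seteqP; split=> x; first by move=> /nomax[y Uy xy]; exists y.
  by case=> y Uy; exact: lowU.
by apply: bigcup_open => x _.
Qed.

(** * The order topology of two separating nests *)

Theorem corollary3 (X : Type) (L R : set (set X))
    (nestL : nest L) (nestR : nest R)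
    (sepLR : T1_separating (L `|` R))
    (connX : connected [set: subbase_topology (L `|` R)]) :
  LOTS (subbase_topology (L `|` R)).
Proof.
set T := subbase_topology (L `|` R).
have ltR x y := @separating_nests_lt_rev X L R x y nestL nestR sepLR.
have totL (x y : X) : x <> y -> nest_lt L x y \/ nest_lt L y x.
  by case/(separating_nests_lt nestL nestR sepLR) => -[]; [left|right].
have totR (x y : X) : x <> y -> nest_lt R x y \/ nest_lt R y x.
  by case/(separating_nests_lt nestL nestR sepLR) => -[]; [right|left].
have [O ltO] := @strict_total_Order (Order.Disp tt tt) T (nest_lt L)
  (@nest_lt_irr X L) (fun x y z => @nest_lt_trans X L x y z nestL) totL.
exists (Order.Disp tt tt), O.
have openL (x : T) : open [set y : T | nest_lt L y x].
  by apply: (@nest_ray_open T L) => U LU; apply: subbase_open; left.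
have openR (x : T) : open [set y : T | nest_lt R y x].
  by apply: (@nest_ray_open T R) => U RU; apply: subbase_open; right.
apply/seteqP; split.
  apply: order_open_min => x.
    by under eq_set do rewrite (propext (ltO _ _)).
  by under eq_set do rewrite (propext (ltO _ _)) -(propext (ltR _ _)).
pose oT : topologicalType := order_topology (Order.Total.Pack O).
have openLO (x : oT) : open [set y : oT | nest_lt L y x].
  have := lray_open (x : oT); rewrite set_itvNyo.
  by under eq_set do rewrite (propext (ltO _ _)).
have openRO (x : oT) : open [set y : oT | nest_lt R y x].
  have := rray_open (x : oT); rewrite set_itvoy.
  by under eq_set do rewrite (propext (ltO _ _)) -(propext (ltR _ _)).
apply: (@subbase_open_min oT) => U LRU.
have oU : @open T U by exact: subbase_open.
(* Lower sets for the order of [R] are the upper sets for that of [L]; the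
   rays above a point for one order are the rays below it for the other. *)
case: LRU => [LU|RU].
- have lowU x y := @nest_lower X L U x y nestL LU.
  have [|->|nomax] := @connected_open_lower_no_max T (nest_lt L) U totL
    (fun x y => @nest_lt_asym X L x y nestL) connX _ oU lowU.
  + by move=> x; under eq_set do rewrite -(propext (ltR _ _)).
  + exact: openT.
  + exact: (@no_max_lower_open oT (nest_lt L) U).
- have lowU x y := @nest_lower X R U x y nestR RU.
  have [|->|nomax] := @connected_open_lower_no_max T (nest_lt R) U totR
    (fun x y => @nest_lt_asym X R x y nestR) connX _ oU lowU.
  + by move=> x; under eq_set do rewrite (propext (ltR _ _)).
  + exact: openT.
  + exact: (@no_max_lower_open oT (nest_lt R) U).
Qed.
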